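(* Let $(F,+,* )$ be a finite presemifield, and let $1$ denote a fixed nonzero element of $F$. Let $\alpha\colon F\to F$ be the map defined by $\alpha(x)*1=x$ for all $x\in F$ (equivalently $\alpha(x)=\gamma(\beta(x))$, where $\beta,\gamma\colon F\to F$ are defined by $1*\beta(x)=x$ and $\gamma(x)*1=1*x$). Then $(F,+,* )$ is isotopic to a commutative semifield if and only if there is some $v\in F$, $v\ne0$, such that $$\alpha(v*x)*y=\alpha(v*y)*x\qquad\text{for all }x,y\in F.$$
   Context: A finite presemifield $(F,+,* )$ is a finite abelian group $(F,+)$ with a multiplication satisfying both distributive laws and such that $x*y=0$ implies $x=0$ or $y=0$; a semifield is a presemifield with a multiplicative identity. Two presemifields $(F,+,* )$ and $(F',+,*')$ are isotopic if there are additive group isomorphisms $A,B,C\colon F\to F'$ with $A(x)*'B(y)=C(x*y)$ for all $x,y\in F$. *)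

(* Defs.v *)
From HB Require Import structures.
From mathcomp Require Import all_boot all_order all_algebra.
Set Implicit Arguments.
Unset Strict Implicit.
Unset Printing Implicit Defensive.
Import GRing.Theory.
Local Open Scope ring_scope.

Definition presemifield (F : finZmodType) (mul : F -> F -> F) : Prop :=
  [/\ left_distributive mul +%R,
      right_distributive mul +%R
    & forall x y : F, mul x y = 0 -> x = 0 \/ y = 0].

Definition semifield (F : finZmodType) (mul : F -> F -> F) : Prop :=
  presemifield mul /\
  exists u : F, left_id u mul /\ right_id u mul.

Definition commutative_semifield (F : finZmodType) (mul : F -> F -> F) : Prop :=
  semifield mul /\ commutative mul.

Definition isotopic (F F' : finZmodType)
    (mul : F -> F -> F) (mul' : F' -> F' -> F') : Prop :=
  exists A B C : {additive F -> F'},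
    [/\ bijective A, bijective B, bijective C
      & forall x y : F, mul' (A x) (B y) = C (mul x y)].

(* In a finite presemifield both translations by a nonzero element are
   bijective, so the equations defining the maps alpha, beta and gamma of the
   theorem always have exactly one solution. *)
Lemma presemifield_divl (F : finZmodType) (mul : F -> F -> F) (a b : F) :
  presemifield mul -> a != 0 -> exists! x : F, mul x a = b.
Proof.
case=> Dl _ dom a0.
have inj : injective (mul^~ a).
  move=> x y /= exy; have : mul (x - y) a = 0.
    by apply: (addIr (mul y a)); rewrite -Dl subrK add0r.
  by case/dom => [/subr0_eq | /eqP]; rewrite ?(negPf a0).
have [g _ gK] := injF_bij inj; exists (g b); split; first exact: gK.
by move=> x ex; apply: inj; rewrite /= ex; exact: gK.
Qed.

Lemma presemifield_divr (F : finZmodType) (mul : F -> F -> F) (a b : F) :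
  presemifield mul -> a != 0 -> exists! x : F, mul a x = b.
Proof.
case=> Dl Dr dom; apply: (@presemifield_divl F (fun x y => mul y x)).
by split=> // x y /dom[]; [right | left].
Qed.

(* Main.v *)
Require Import Defs.
From HB Require Import structures.
From mathcomp Require Import all_boot all_order all_algebra.
Import GRing.Theory.
Local Open Scope ring_scope.

(** Write [x * y] for [mul x y].  The formula for [alpha] follows by cancelling
    [e] on the right in [gamma (beta x) * e = e * beta x = x = alpha x * e].

    For the equivalence, the condition on [v] says that the product
    [alpha (v * x) * y], an isotope of [*], is commutative.

    Suppose that [A], [B], [C] are an isotopism onto a commutative
    multiplication.  Carrying that multiplication back to [F] along [B] on both
    factors shows that [D x * y = D y * x] for [D = A^-1 \o B].  Taking [y = e]
    gives [D x * e = D e * x], that is [D x = alpha (D e * x)], so that the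
    symmetry of [D x * y] is the required condition with [v = D e].

    Conversely, given [v], let [g] be the inverse of [x |-> v * x] and consider
    the product [alpha x * g y].  It is isotopic to [*] through right
    multiplication by [e], left multiplication by [v] and the identity.  As
    every element has the form [v * x], the condition says exactly that this
    product is commutative, and [v * e] is an identity element for it by the
    same condition: [alpha (v * e) * g y = alpha (v * g y) * e = y]. *)

Lemma presemifield_mulIl (F : finZmodType) (mul : F -> F -> F) (a : F) :
  presemifield mul -> a != 0 -> injective (mul^~ a).
Proof.
move=> hF a0 x y /= exy.
have [z [_ uz]] := presemifield_divl (mul y a) hF a0.
by rewrite -(uz _ exy) -(uz y).
Qed.

Lemma presemifield_mulIr (F : finZmodType) (mul : F -> F -> F) (a : F) :
  presemifield mul -> a != 0 -> injective (mul a).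
Proof.
move=> hF a0 x y /= exy.
have [z [_ uz]] := presemifield_divr (mul a y) hF a0.
by rewrite -(uz _ exy) -(uz y).
Qed.

(** Isotopisms are made of bundled additive maps, whereas translations in a
    presemifield come as bare functions with a distributive law. *)
Lemma morphD_additive (U V : zmodType) (f : U -> V) :
  {morph f : x y / x + y} -> exists g : {additive U -> V}, g =1 f.
Proof.
move=> fD.
have fB : zmod_morphism f.
  by move=> x y; apply: (addIr (f y)); rewrite -fD !subrK.
pose fM := GRing.isZmodMorphism.Build U V f fB.
pose g : {additive U -> V} := HB.pack f fM.
by exists g.
Qed.

(** All the axioms pull back along the bijections of an isotopism, because each
    of them is additive. *)
Lemma isotopic_presemifield (F F' : finZmodType)
    (mul : F -> F -> F) (mul' : F' -> F' -> F') :
  isotopic mul mul' -> presemifield mul -> presemifield mul'.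
Proof.
move=> [A [B [C [[A' _ AK] [B' _ BK] bC mulE]]]] [Dl Dr dom]; split.
- move=> x y z; rewrite -(AK x) -(AK y) -(BK z).
  by rewrite -raddfD !mulE Dl raddfD.
- move=> x y z; rewrite -(AK x) -(BK y) -(BK z).
  by rewrite -raddfD !mulE Dr raddfD.
move=> x y; rewrite -(AK x) -(BK y) mulE -{1}(raddf0 C).
by move=> /(bij_inj bC)/dom[] ->; rewrite raddf0; [left | right].
Qed.

(** For [D = A^-1 \o B], applying [C] to both sides turns the symmetry of
    [mul (D x) y] into that of [mul' (B x) (B y)]. *)
Lemma isotopic_commutative_twist (F F' : finZmodType)
    (mul : F -> F -> F) (mul' : F' -> F' -> F') :
  commutative mul' -> isotopic mul mul' ->
  exists D : F -> F, (forall x, D x = 0 -> x = 0) /\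
    forall x y, mul (D x) y = mul (D y) x.
Proof.
move=> mulC [A [B [C [[A' _ AK] bB bC mulE]]]].
exists (A' \o B); split=> [x /= Dx0 | x y /=].
  by apply: (bij_inj bB); rewrite -(AK (B x)) Dx0 !raddf0.
by apply: (bij_inj bC); rewrite -!mulE !AK mulC.
Qed.

(** The symmetry at [y = e] determines [D] from its value at [e]: this is where
    [v = D e] comes from. *)
Lemma commutative_twist_alpha (F : finZmodType) (mul : F -> F -> F)
    (e : F) (alpha D : F -> F) :
  presemifield mul -> e != 0 -> (forall x, mul (alpha x) e = x) ->
  (forall x y, mul (D x) y = mul (D y) x) ->
  forall x, alpha (mul (D e) x) = D x.
Proof.
move=> hF e0 alphaK DC x.
by apply: (presemifield_mulIl _ _ _ hF e0); rewrite /= alphaK DC.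
Qed.

(** Inverting the translations by [e] and [v] is the usual way to make an
    isotope with identity [v * e]; here the map [alpha] is already one of the
    two inverses. *)
Lemma translation_isotopic (F : finZmodType) (mul : F -> F -> F)
    (e v : F) (alpha g : F -> F) :
  presemifield mul -> e != 0 -> v != 0 ->
  (forall x, mul (alpha x) e = x) -> (forall x, mul v (g x) = x) ->
  isotopic mul (fun x y => mul (alpha x) (g y)).
Proof.
move=> hF e0 v0 alphaK gK; have [Dl Dr _] := hF.
have Ie := presemifield_mulIl _ _ _ hF e0.
have Iv := presemifield_mulIr _ _ _ hF v0.
have [A AE] := morphD_additive _ _ (mul^~ e) (fun x y => Dl x y e).
have [B BE] := morphD_additive _ _ (mul v) (Dr v).
exists A, B, idfun; split=> [|||x y].
- by apply: injF_bij; apply: eq_inj Ie _ => x; rewrite AE.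
- by apply: injF_bij; apply: eq_inj Iv _ => x; rewrite BE.
- by exists idfun.
have -> : alpha (A x) = x by apply: Ie; rewrite /= alphaK AE.
by have -> : g (B y) = y by apply: Iv; rewrite gK BE.
Qed.

Theorem corollary3p9 (F : finZmodType) (mul : F -> F -> F)
    (hF : presemifield mul)
    (e : F) (he : e != 0)
    (alpha : F -> F) (halpha : forall x : F, mul (alpha x) e = x) :
  (forall beta gamma : F -> F,
     (forall x : F, mul e (beta x) = x) ->
     (forall x : F, mul (gamma x) e = mul e x) ->
     forall x : F, alpha x = gamma (beta x)) /\
  ((exists (F' : finZmodType) (mul' : F' -> F' -> F'),
      commutative_semifield mul' /\ isotopic mul mul') <->
   (exists v : F, v != 0 /\
      forall x y : F, mul (alpha (mul v x)) y = mul (alpha (mul v y)) x)).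
Proof.
split.
  move=> beta gamma betaK gammaE x.
  by apply: (presemifield_mulIl _ _ _ hF he); rewrite /= halpha gammaE betaK.
split=> [[F' [mul' [[_ mulC] iso]]] | [v [v0 vC]]].
  have [D [D0 DC]] := isotopic_commutative_twist _ _ _ _ mulC iso.
  exists (D e); split; first by apply: contra_neq he; exact: D0.
  by move=> x y; rewrite !(commutative_twist_alpha _ _ _ _ _ hF he halpha DC).
have [g _ gK] := injF_bij (presemifield_mulIr _ _ _ hF v0).
have iso := translation_isotopic _ _ _ _ _ _ hF he v0 halpha gK.
have mulC : commutative (fun x y => mul (alpha x) (g y)).
  by move=> x y; rewrite -{1}(gK x) -{2}(gK y) vC.
have mul1 : left_id (mul v e) (fun x y => mul (alpha x) (g y)).
  by move=> y; rewrite vC gK halpha.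
exists F, (fun x y => mul (alpha x) (g y)); split=> //; split=> //.
split; first exact: isotopic_presemifield iso hF.
by exists (mul v e); split=> // x; rewrite mulC mul1.
Qed.
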